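(* Let $P$ be a symmetric polytope in $\mathbb{R}^n$. Then there exists $p_0=p_0(P)\ge 2$ such that for every $p\ge p_0$ (with $p<\infty$) there exists a $p$-uniformly convex body $K_p$ in $\mathbb{R}^n$ such that $$d_s(P,K_p)\le 2n^2\,|P|\,\frac{\log p}{p}.$$
   Context: $|\cdot|$ denotes volume in $\mathbb{R}^n$. A convex body is a compact convex set with non-empty interior; a polytope in $\mathbb{R}^n$ is a convex body that is the convex hull of finitely many points. A convex body $C$ is symmetric if $x\in C$ implies $-x\in C$. The symmetric difference metric between convex bodies $C$ and $K$ is $d_s(C,K)=|(C\setminus K)\cup(K\setminus C)|$. For a symmetric convex body $K$, $\|\cdot\|_K$ denotes the norm on $\mathbb{R}^n$ whose closed unit ball is $K$. For $2\le p<\infty$, a symmetric convex body $K$ is called $p$-uniformly convex (with constant $C_p>0$) if for every $x,y\in\partial K$, $$\left\|\frac{x+y}{2}\right\|_K\le 1-C_p\,\|x-y\|_K^{p}.$$ A body is $p$-uniformly convex if this holds for some constant $C_p>0$. *)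

(* Defs.v *)
From HB Require Import structures.
From mathcomp Require Import all_boot all_order all_algebra.
From mathcomp Require Import all_classical all_reals all_analysis.
Import Order.TTheory GRing.Theory Num.Theory.
Import numFieldNormedType.Exports.

Set Implicit Arguments.
Unset Strict Implicit.
Unset Printing Implicit Defensive.

Local Open Scope classical_set_scope.
Local Open Scope ring_scope.

Section sigma_finite_measure_of.
Context d (T : measurableType d) (R : realType).
Variable m : {measure set T -> \bar R}.
Hypothesis m_sigma_finite : sigma_finite setT m.

Let mu : set T -> \bar R := m.

HB.instance Definition _ := Measure.on mu.
HB.instance Definition _ := Measure_isSigmaFinite.Build _ _ _ mu m_sigma_finite.

Lemma sigma_finite_measureP :
  exists mu : {sigma_finite_measure set T -> \bar R},
    m = mu :> (set T -> \bar R).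
Proof. by exists mu. Qed.

End sigma_finite_measure_of.

Section volume.
Context {R : realType}.

Definition cons_pair n (xt : R * n.-tuple R) : n.+1.-tuple R :=
  [tuple of xt.1 :: xt.2].

(* n-dimensional Lebesgue measure: the n-fold product of lebesgue_measure,
   carried by tuples because they have a product sigma-algebra and row vectors
   do not. *)
Fixpoint lebesgue_tuple n : set (n.-tuple R) -> \bar R :=
  match n with
  | 0 => \d_[tuple]
  | n'.+1 =>
      pushforward (@lebesgue_measure R \x @lebesgue_tuple n')%E (@cons_pair n')
  end.

Lemma measurable_cons_pair n : measurable_fun setT (@cons_pair n).
Proof.
exact: (measurable_cons (f := fst) (g := snd) measurable_fst measurable_snd).
Qed.

Definition tuple_box n (A : 'I_n -> set R) : set (n.-tuple R) :=
  [set t | forall i, A i (tnth t i)].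

Lemma preimage_cons_pair_box n (A : 'I_n.+1 -> set R) :
  @cons_pair n @^-1` tuple_box A =
  A ord0 `*` tuple_box (fun i => A (lift ord0 i)).
Proof.
apply/seteqP; split => [[x t] /= At|[x t] /= [A0 At] i].
  by split; [exact: At ord0|move=> i; have := At (lift ord0 i); rewrite tnthS].
have [j ->|->] := unliftP ord0 i; last exact: A0.
by rewrite tnthS; exact: At.
Qed.

Lemma measurable_tuple_box n (A : 'I_n -> set R) :
  (forall i, measurable (A i)) -> measurable (tuple_box A).
Proof.
move=> mA.
have -> : tuple_box A =
    \bigcap_(i in [set: 'I_n]) ((@tnth n R ^~ i) @^-1` A i).
  by apply/seteqP; split => [t At i _|t At i]; exact: At.
apply: fin_bigcap_measurable => // i _.
by rewrite -[X in measurable X]setTI; exact: measurable_tnth.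
Qed.

Let nat_box n (k : nat) : set (n.-tuple R) :=
  tuple_box (fun=> `[- k%:R, k%:R]%classic).

Let bigcup_nat_box n : \bigcup_k @nat_box n k = setT.
Proof.
apply/seteqP; split => // t _.
exists (\max_(i < n) Num.trunc `|tnth t i|).+1 => // i /=.
rewrite in_itv /= -ler_norml.
apply: (le_trans (ltW (truncnS_gt `|tnth t i|))).
by rewrite ler_nat ltnS (leq_bigmax i).
Qed.

Lemma lebesgue_tuple_spec n :
  exists mu : {sigma_finite_measure set (n.-tuple R) -> \bar R},
    (@lebesgue_tuple n = mu :> (set (n.-tuple R) -> \bar R)) /\
    (forall A : 'I_n -> set R, (forall i, measurable (A i)) ->
       mu (tuple_box A) = \prod_(i < n) lebesgue_measure (A i))%E.
Proof.
elim: n => [|n [nu [/= -> nuE]]].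
  exists \d_([tuple] : 0.-tuple R); split=> // A _.
  by rewrite big_ord0 /= diracE mem_set// => -[].
pose mu0 := measure_function_pushforward__canonical__measure_function_Measure
  (@lebesgue_measure R \x nu)%E (@measurable_cons_pair n).
have boxE (A : 'I_n.+1 -> set R) : (forall i, measurable (A i)) ->
    (mu0 (tuple_box A) = \prod_(i < n.+1) lebesgue_measure (A i))%E.
  move=> mA; rewrite /= /pushforward preimage_cons_pair_box.
  rewrite product_measure1E//; last exact: measurable_tuple_box.
    by rewrite big_ord_recl nuE.
  exact: mA.
have fin : sigma_finite setT mu0.
  exists (@nat_box n.+1); first by rewrite bigcup_nat_box.
  move=> k; split; first exact: measurable_tuple_box.
  rewrite boxE// -ge0_fin_numE ?prode_ge0// prode_fin_num// => i _.
  by rewrite lebesgue_measure_itv/=; case: ifP.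
have [mu muE] := sigma_finite_measureP fin.
by exists mu; split=> [|A mA]; rewrite -muE// boxE.
Qed.

Lemma lebesgue_tuple_box n (A : 'I_n -> set R) :
  (forall i, measurable (A i)) ->
  (lebesgue_tuple (tuple_box A) = \prod_(i < n) lebesgue_measure (A i))%E.
Proof. by have [mu [-> muE]] := lebesgue_tuple_spec n; exact: muE. Qed.

Let lebesgue_tuple0 n : @lebesgue_tuple n set0 = 0%E.
Proof. by have [mu [-> _]] := lebesgue_tuple_spec n; exact: measure0. Qed.

Let lebesgue_tuple_ge0 n A : (0 <= @lebesgue_tuple n A)%E.
Proof. by have [mu [-> _]] := lebesgue_tuple_spec n; exact: measure_ge0. Qed.

Let lebesgue_tuple_sigma_additive n :
  semi_sigma_additive (@lebesgue_tuple n).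
Proof.
by have [mu [-> _]] := lebesgue_tuple_spec n; exact: measure_semi_sigma_additive.
Qed.

HB.instance Definition _ n := isMeasure.Build _ _ _ (@lebesgue_tuple n)
  (@lebesgue_tuple0 n) (@lebesgue_tuple_ge0 n)
  (@lebesgue_tuple_sigma_additive n).

Let lebesgue_tuple_sigma_finite n : sigma_finite setT (@lebesgue_tuple n).
Proof. by have [mu [-> _]] := lebesgue_tuple_spec n; exact: sigma_finiteT. Qed.

HB.instance Definition _ n := Measure_isSigmaFinite.Build _ _ _
  (@lebesgue_tuple n) (@lebesgue_tuple_sigma_finite n).

Definition volume n (A : set 'rV[R]_n) : \bar R :=
  lebesgue_tuple [set t : n.-tuple R | A (\row_i tnth t i)].

Definition symdiff_dist n (C K : set 'rV[R]_n) : \bar R := volume (C `+` K).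

End volume.

Section convex_bodies.
Context {R : realType} {n : nat}.
Implicit Types (A C K P : set 'rV[R]_n) (x y : 'rV[R]_n).

Definition convex_body C := [/\ convex_set C, compact C & C° !=set0].

Definition symmetric_set C := forall x, C x -> C (- x).

Definition convex_hull A : set 'rV[R]_n := smallest (@convex_set R 'rV[R]_n) A.

Definition polytope P :=
  convex_body P /\
  exists2 V : set 'rV[R]_n, finite_set V & P = convex_hull V.

Definition boundary A := closure A `\` A°.

(* Minkowski functional; for a symmetric convex body K it is the norm whose
   closed unit ball is K: see body_norm_eq0, body_normZ, body_normD and
   body_norm_ball. *)
Definition body_norm K x : R := inf [set t : R | 0 < t /\ K (t^-1 *: x)].

Definition p_uniformly_convex_with (p c : R) K :=
  forall x y, boundary K x -> boundary K y ->
    body_norm K (2^-1 *: (x + y)) <= 1 - c * body_norm K (x - y) `^ p.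

Definition p_uniformly_convex_body (p : R) K :=
  [/\ convex_body K, symmetric_set K &
      exists2 c : R, 0 < c & p_uniformly_convex_with p c K].

Section body_norm.
Variable K : set 'rV[R]_n.
Hypotheses (bK : convex_body K) (sK : symmetric_set K).

Let S x := [set t : R | 0 < t /\ K (t^-1 *: x)].

Let convK (a b : R) x y : K x -> K y -> 0 <= a -> 0 <= b -> a + b = 1 ->
  K (a *: x + b *: y).
Proof.
move=> Kx Ky a0 b0 ab.
have a1 : a <= 1 by rewrite -ab lerDl.
have [cK _ _] := bK.
have := cK x y (Itv01 a0 a1) (mem_set Kx) (mem_set Ky).
rewrite inE; congr K; rewrite /conv/=; congr (_ + _ *: _).
by rewrite /unstable.onem -ab addrAC subrr add0r.
Qed.

Let nbhs0K : exists2 e : R, 0 < e & forall v, `|v| < e -> K v.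
Proof.
have [_ _ [x0 /nbhs_ballP[e /= e0 eK]]] := bK.
exists (e / 2); first by rewrite divr_gt0.
move=> v ve.
have K1 : K (x0 + 2 *: v).
  apply: eK; rewrite -ball_normE/= opprD addNKr normrN normrZ ger0_norm//.
  by rewrite mulrC -ltr_pdivlMr.
have K2 : K (- x0) by apply: sK; apply: eK; exact: ballxx.
have := @convK 2^-1 2^-1 _ _ K1 K2.
rewrite scalerDr scalerN scalerA mulVf// scale1r addrAC subrr add0r.
by apply; rewrite ?invr_ge0// [RHS]splitr !mul1r.
Qed.

Let K0 : K 0.
Proof. by have [e e0] := nbhs0K; apply; rewrite normr0. Qed.

Let S_neq0 x : S x !=set0.
Proof.
have [e e0 eK] := nbhs0K.
have x1 : 0 < (`|x| + 1) / e by rewrite divr_gt0// ltr_wpDl.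
exists ((`|x| + 1) / e); split => //; apply: eK.
rewrite normrZ gtr0_norm ?invr_gt0// invf_div.
by rewrite mulrAC ltr_pdivrMr ?ltr_wpDl// ltr_pM2l// ltrDl.
Qed.

Let S_lbound x : lbound (S x) 0.
Proof. by move=> t [/ltW]. Qed.

Let norm_lt x t : body_norm K x < t -> S x t.
Proof.
move=> /(inf_lt (S_neq0 x)) [s [s0 Ks] st].
have t0 := lt_trans s0 st; split => //.
have := @convK (s / t) (1 - s / t) _ _ Ks K0.
rewrite scaler0 addr0 scalerA mulrAC divff ?gt_eqF// mul1r; apply.
- by rewrite divr_ge0// ltW.
- by rewrite subr_ge0 ler_pdivrMr// mul1r ltW.
- by rewrite addrC subrK.
Qed.

Let norm_le x t : S x t -> body_norm K x <= t.
Proof. move=> St; apply: (ge_inf _ St); exists 0; exact: S_lbound. Qed.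

Lemma body_norm_ge0 x : 0 <= body_norm K x.
Proof. exact: (lb_le_inf (S_neq0 x) (@S_lbound x)). Qed.

Lemma body_norm_eq0 x : body_norm K x = 0 -> x = 0.
Proof.
have [_ /compact_bounded[M [_ MK]] _] := bK; move=> x0.
have {}MK y : K y -> `|y| <= `|M| + 1.
  by apply: MK; rewrite ltr_pwDr// ler_norm.
have M0 : 0 < `|M| + 1 by rewrite ltr_wpDl.
apply/eqP; rewrite -normr_eq0 eq_le normr_ge0 andbT.
apply/ler_addgt0Pr => e e0; rewrite add0r.
have [t0 /MK] : S x (e / (`|M| + 1)) by apply: norm_lt; rewrite x0 divr_gt0.
rewrite normrZ gtr0_norm ?invr_gt0// invf_div mulrAC ler_pdivrMr//.
by rewrite ler_pM2l.
Qed.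

Let normZ_le a x : a != 0 -> body_norm K (a *: x) <= `|a| * body_norm K x.
Proof.
move=> a0; rewrite -ler_pdivrMl ?normr_gt0//;
apply: (lb_le_inf (S_neq0 x)) => t [t0 Kt].
rewrite ler_pdivrMl ?normr_gt0//; apply: norm_le; split.
  by rewrite mulr_gt0// normr_gt0.
have -> : (`|a| * t)^-1 *: (a *: x) = (a / `|a|) *: (t^-1 *: x).
  by rewrite !scalerA invfM; congr (_ *: _); rewrite [LHS]mulrC mulrA.
have [a1|a1] := ltP 0 a; first by rewrite gtr0_norm// divff// scale1r.
rewrite ler0_norm// invrN mulrN divff// scaleN1r; exact: sK.
Qed.

Lemma body_normZ a x : body_norm K (a *: x) = `|a| * body_norm K x.
Proof.
have [->|a0] := eqVneq a 0.
  rewrite scale0r normr0 mul0r; apply/eqP; rewrite eq_le body_norm_ge0 andbT.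
  apply/ler_addgt0Pr => e e0; rewrite add0r; apply: norm_le; split => //.
  by rewrite scaler0.
apply/eqP; rewrite eq_le normZ_le//=.
rewrite -ler_pdivlMl ?normr_gt0// -normfV.
by rewrite -[in leLHS](scalerK a0 x) normZ_le// invr_eq0.
Qed.

Lemma body_normD x y : body_norm K (x + y) <= body_norm K x + body_norm K y.
Proof.
apply/ler_addgt0Pr => e e0.
have e2 : 0 < e / 2 by rewrite divr_gt0.
have [s0 Ks] : S x (body_norm K x + e / 2) by apply: norm_lt; rewrite ltrDl.
have [t0 Kt] : S y (body_norm K y + e / 2) by apply: norm_lt; rewrite ltrDl.
rewrite [e]splitr addrACA.
set s := _ + _ in s0 Ks *; set t := body_norm K y + _ in t0 Kt *.
have st0 : 0 < s + t by rewrite addr_gt0.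
apply: norm_le; split => //.
have := @convK (s / (s + t)) (t / (s + t)) _ _ Ks Kt.
rewrite !scalerA !(mulrAC _ (s + t)^-1) !divff ?gt_eqF// !mul1r -scalerDr.
apply; rewrite ?divr_ge0// ?ltW//.
by rewrite -mulrDl divff ?gt_eqF.
Qed.

Lemma body_norm_ball : [set x | body_norm K x <= 1] = K.
Proof.
have [_ cK _] := bK.
have {}cK : closed K by apply: compact_closed => //; exact: norm_hausdorff.
apply/seteqP; split => x /=; last first.
  by move=> Kx; apply: norm_le; split => //; rewrite invr1 scale1r.
move=> x1; apply: cK.
move=> B /nbhs_ballP[e /= e0 eB].
pose t := 1 + e / (`|x| + 1).
have x10 : 0 < `|x| + 1 by rewrite ltr_wpDl.
have d0 : 0 < e / (`|x| + 1) by rewrite divr_gt0.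
have [t0 Kt] : S x t by apply: norm_lt; rewrite (le_lt_trans x1)// ltrDl.
exists (t^-1 *: x); split => //; apply: eB; rewrite -ball_normE/=.
have -> : x - t^-1 *: x = ((e / (`|x| + 1)) / t) *: x.
  rewrite -[in LHS](scale1r x) scalerA mulr1 -scalerBl; congr (_ *: _).
  rewrite -[X in X - _](@divff _ t) ?gt_eqF// -{2}[t^-1]mul1r -mulrBl.
  by rewrite addrC addKr.
rewrite normrZ gtr0_norm ?divr_gt0// mulrAC ltr_pdivrMr//.
rewrite mulrAC ltr_pdivrMr// -mulrA ltr_pM2l//.
apply: (@lt_le_trans _ _ (`|x| + 1)); first by rewrite ltrDl.
have t1 : 1 <= t by rewrite lerDl ltW.
by rewrite ler_peMl// ltW.
Qed.

End body_norm.

End convex_bodies.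

(* Main.v *)
(* Let s = 1 - ln p / p, and let K be the unit ball of the norm N given by
   N(x)^2 = |x|_P^2 + e * |x|_2^2.  The Euclidean term makes K 2-uniformly convex,
   hence p-uniformly convex for every p >= 2, because |x - y|_K <= 2 on K and the
   constant may depend on p.  As P is bounded, sP <= K <= P once e is small, so
   |P \ K| <= (1 - s^n) |P| <= n (1 - s) |P|. *)
Require Import Defs.
From mathcomp Require Import all_boot all_order all_algebra.
From mathcomp Require Import ring lra.
From mathcomp Require Import all_classical all_reals all_analysis.
Import Order.TTheory GRing.Theory Num.Theory.
Import numFieldNormedType.Exports.
Local Open Scope classical_set_scope.
Local Open Scope ring_scope.

(** * Measurability of open and closed sets, read on tuples of coordinates *)

Lemma norm_coord_le {R : realType} {n : nat} (x : 'rV[R]_n) (i : 'I_n) :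
  `|x 0 i| <= `|x|.
Proof.
rewrite [leRHS]mx_normrE.
exact: (@le_bigmax _ _ _ 0 (fun ij => `|x ij.1 ij.2|) (0, i)).
Qed.

(** The topology lives on row vectors and the sigma-algebra on tuples. The bridge is that an open
    set is the union of the open boxes with rational endpoints that it contains, and there are
    countably many of these. *)
Lemma measurable_open_tuple {R : realType} {n : nat} {U : set 'rV[R]_n} :
  open U -> measurable [set t : n.-tuple R | U (\row_i tnth t i)].
Proof.
move=> oU.
pose box (c : n.-tuple (rat * rat)) : set (n.-tuple R) :=
  tuple_box (fun i => `]ratr (tnth c i).1, ratr (tnth c i).2[%classic).
pose V := [set t : n.-tuple R | U (\row_i tnth t i)].
change (measurable V).
(* A box not inside [V] contributes the empty set, so the union can run over the whole countable
   type of rational boxes. *)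
rewrite (_ : V = \bigcup_c (if `[< box c `<=` V >] then box c else set0)).
  apply: countable_bigcupT_measurable => [|c]; first exact: countableP.
  by case: ifP => // _; exact: measurable_tuple_box.
apply/seteqP; split => [t Vt|t [c _]]; last first.
  by case: asboolP => // cV /cV.
have /nbhs_ballP[e /= e0 eU] : nbhs (\row_i tnth t i) U.
  by apply: open_nbhs_nbhs; split.
(* Endpoints within [e] of each coordinate keep the box inside the ball, since balls of row vectors
   are taken entrywise. *)
have /choice[a ta] (i : 'I_n) :
    exists q, ratr q \in `]tnth t i - e, tnth t i[.
  by apply: rat_in_itvoo; rewrite ltrBlDr ltrDl.
have /choice[b tb] (i : 'I_n) :
    exists q, ratr q \in `]tnth t i, tnth t i + e[.
  by apply: rat_in_itvoo; rewrite ltrDl.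
pose c := [tuple (a i, b i) | i < n].
exists c => //.
have cV : box c `<=` V.
  move=> u cu; apply: eU; split => //= i j; rewrite !mxE.
  have := cu j; rewrite /= tnth_mktuple /= in_itv /= => /andP[au ub].
  have := ta j; have := tb j; rewrite !in_itv /= => /andP[_ be] /andP[ae _].
  rewrite /ball /= ltr_distlC.
  by rewrite (lt_trans ae au) (lt_trans ub be).
rewrite (asboolT cV) => i; rewrite /= tnth_mktuple /= in_itv /=.
have := ta i; have := tb i; rewrite !in_itv /= => /andP[-> _] /andP[_ ->].
by [].
Qed.

Lemma measurable_closed_tuple {R : realType} {n : nat} {C : set 'rV[R]_n} :
  closed C -> measurable [set t : n.-tuple R | C (\row_i tnth t i)].
Proof.
move=> cC; rewrite -[X in measurable X]setCK; apply: measurableC.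
exact: (measurable_open_tuple (closed_openC cC)).
Qed.

(** * Dilation and finiteness of volume *)

(** The right side is a measure that gives half-open intervals their length, so uniqueness of
    Lebesgue measure applies. *)
Lemma lebesgue_measure_scale (R : realType) (s : R) (A : set R) :
  0 < s -> measurable A ->
  lebesgue_measure A = (s%:E * lebesgue_measure (( *%R s) @^-1` A))%E.
Proof.
move=> s0 mA.
have mf : measurable_fun setT ( *%R s : measurableTypeR R -> measurableTypeR R).
  exact: measurable_realfun.mulrl_measurable.
pose m : {measure set (measurableTypeR R) -> \bar R} := mscale (NngNum (ltW s0))
  (measure_function_pushforward__canonical__measure_function_Measure
    (@lebesgue_measure R) mf).
transitivity (m A) => //.
refine (@lebesgue_measure_unique R m _ A mA) => X [[a b]] _ <-.
change (lebesgue_measure `]a, b] =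
  s%:E * lebesgue_measure ( *%R s @^-1` `]a, b]))%E.
rewrite (_ : _ @^-1` _ = `](s^-1 * a), (s^-1 * b)]%classic); last first.
  by apply/seteqP; split => x /=; rewrite !in_itv /= ltr_pdivrMl ?ler_pdivlMl.
rewrite !lebesgue_measure_itv /= !lte_fin ltr_pM2l ?invr_gt0 //.
case: ifP => _; last by rewrite mule0.
by rewrite -!EFinD -EFinM -mulrBr mulrA divff ?gt_eqF // mul1r.
Qed.

Definition tuple_scale {R : realType} {n : nat} (s : R) (t : n.-tuple R) :
    n.-tuple R := [tuple of map ( *%R s) t].

(** Induction on the dimension through uniqueness of the product measure. On a measurable rectangle
    the factor [s ^+ n.+1] splits into [s] for the first coordinate and [s ^+ n] for the others. *)
Lemma lebesgue_tuple_scale (R : realType) (n : nat) (s : R)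
    (A : set (n.-tuple R)) : 0 < s -> measurable A ->
  lebesgue_tuple A =
  ((s ^+ n)%:E * lebesgue_tuple (tuple_scale s @^-1` A))%E.
Proof.
move=> s0; elim: n A => [|n IH] A mA.
  rewrite expr0 mul1e /=; congr (\d_ _ _)%E; apply/seteqP.
  by split => t /=; rewrite (tuple0 t) (tuple0 (tuple_scale s _)).
have ms m : measurable_fun setT (@tuple_scale R m s).
  apply/measurable_fun_tnthP => i.
  rewrite (_ : _ \o _ = fun t : m.-tuple R => s * tnth t i); last first.
    by apply/funext => t /=; rewrite tnth_map.
  apply: (measurableT_comp (measurable_realfun.mulrl_measurable s)).
  exact: measurable_tnth.
pose f (xt : measurableTypeR R * n.-tuple R) :
    measurableTypeR R * n.-tuple R := (s * xt.1, tuple_scale s xt.2).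
have mf : measurable_fun setT f.
  apply/measurable_fun_pairP; split.
    apply: (measurableT_comp (measurable_realfun.mulrl_measurable s)).
    exact: measurable_fst.
  exact: (measurableT_comp (ms n) measurable_snd).
have sn0 : 0 <= s ^+ n.+1 by rewrite exprn_ge0 // ltW.
pose m' : {measure set (measurableTypeR R * n.-tuple R) -> \bar R} :=
  mscale (NngNum sn0)
  (measure_function_pushforward__canonical__measure_function_Measure
    (@lebesgue_measure R \x @lebesgue_tuple R n)%E mf).
transitivity (m' (@cons_pair R n @^-1` A)).
  refine (@product_measure_unique _ _ _ _ _ (@lebesgue_measure R)
    (@lebesgue_tuple R n) m' _ _ _).
- move=> B C mB mC.
  transitivity ((s ^+ n.+1)%:E *
    (@lebesgue_measure R \x @lebesgue_tuple R n)
    (( *%R s @^-1` B) `*` (tuple_scale s @^-1` C)))%E; first by [].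
  rewrite product_measure1E; last 2 first.
    rewrite -[X in measurable X]setTI.
    exact: measurable_realfun.mulrl_measurable.
    rewrite -[X in measurable X]setTI; exact: ms.
  transitivity (lebesgue_measure B * lebesgue_tuple C)%E; last by [].
  rewrite (lebesgue_measure_scale _ _ _ s0 mB) (IH _ mC).
  by rewrite exprS EFinM muleACA.
- rewrite -[X in measurable X]setTI.
  exact: measurable_cons_pair.
rewrite /m' /mscale /= /pushforward; congr (_ * (_ \x _) _)%E.
suff fE xt : cons_pair (f xt) = tuple_scale s (cons_pair xt).
  by apply/seteqP; split => xt; rewrite /preimage /= fE.
by apply/eqP; rewrite -val_eqE.
Qed.

Lemma closed_scale (R : realType) (n : nat) (s : R) (C : set 'rV[R]_n) :
  closed C -> closed [set x | C (s *: x)].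
Proof.
exact: (continuous_closedP _).1 (@scaler_continuous _ 'rV[R]_n s) C.
Qed.

(** The set on the left is the dilate [s C], written as a preimage; closedness supplies
    measurability. *)
Lemma volume_scale (R : realType) (n : nat) (s : R) (C : set 'rV[R]_n) :
  0 < s -> closed C ->
  volume [set x | C (s^-1 *: x)] = ((s ^+ n)%:E * volume C)%E.
Proof.
move=> s0 cC; rewrite /volume (@lebesgue_tuple_scale _ _ s _ s0); last first.
  exact: measurable_closed_tuple (closed_scale _ _ _ _ cC).
congr (_ * lebesgue_tuple _)%E.
apply/funext => t /=; congr C; apply/rowP => i.
by rewrite !mxE tnth_map mulKf ?gt_eqF.
Qed.

Lemma volume_compact_lty (R : realType) (n : nat) (C : set 'rV[R]_n) :
  compact C -> (volume C < +oo)%E.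
Proof.
move=> cC; have [M [_ MC]] := compact_bounded cC.
have mC := measurable_closed_tuple (compact_closed (@norm_hausdorff _ _) cC).
(* [compact_bounded] bounds [C] by every number strictly above [M]; this one is also positive, and
   [C] lies in the cube of half-side [N]. *)
pose N := `|M| + 1.
have mB : measurable (@tuple_box R n (fun=> `[- N, N]%classic)).
  exact: measurable_tuple_box.
have := le_measure (@lebesgue_tuple R n) (mem_set mC) (mem_set mB).
move/(_ _)/le_lt_trans; apply.
  move=> t Ct i /=; rewrite in_itv /= -ler_norml.
  have := MC N _ _ Ct; rewrite ltr_pwDr ?ler_norm // => /(_ isT).
  by apply: le_trans; have := norm_coord_le (\row_i tnth t i) i; rewrite mxE.
rewrite /= lebesgue_tuple_box // -ge0_fin_numE ?prode_ge0 //.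
rewrite prode_fin_num // => i _.
by rewrite lebesgue_measure_itv /=; case: ifP.
Qed.

(** * Euclidean square, continuity of norms and comparison of powers *)

Definition sqnorm {R : realType} {n : nat} (x : 'rV[R]_n) : R :=
  \sum_(i < n) x 0 i ^+ 2.

Lemma sqnorm_ge0 {R : realType} {n : nat} (x : 'rV[R]_n) : 0 <= sqnorm x.
Proof. by apply: sumr_ge0 => i _; exact: sqr_ge0. Qed.

Lemma sqnormZ {R : realType} {n : nat} (a : R) (x : 'rV[R]_n) :
  sqnorm (a *: x) = a ^+ 2 * sqnorm x.
Proof.
by rewrite /sqnorm mulr_sumr; apply: eq_bigr => i _; rewrite mxE exprMn.
Qed.

(** The weighted parallelogram identity. Its last term is the source of the uniform convexity of the
    rounded body. *)
Lemma sqnorm_conv {R : realType} {n : nat} (a b : R) (x y : 'rV[R]_n) :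
  a + b = 1 ->
  sqnorm (a *: x + b *: y) =
  a * sqnorm x + b * sqnorm y - a * b * sqnorm (x - y).
Proof.
move=> ab; rewrite /sqnorm !mulr_sumr -sumrN -!big_split /=.
apply: eq_bigr => i _; rewrite !mxE.
have -> : b = 1 - a by rewrite -ab addrAC subrr add0r.
ring.
Qed.

Lemma sqnorm_continuous {R : realType} {n : nat} :
  continuous (@sqnorm R n).
Proof.
apply: continuous_big => [|i _ x]; first exact: add_continuous.
exact: (cvg_comp _ _ (@coord_continuous _ _ _ 0 i x) (@exprn_continuous _ 2 _)).
Qed.

(** Subadditivity bounds [f x - f y] by [f (x - y)] and its opposite by [f (y - x)], so [f] is
    Lipschitz. The constant [|B| + 1] is used because it is positive and can be divided by. *)
Lemma continuous_subadditive {R : realType} {n : nat} (f : 'rV[R]_n -> R)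
    (B : R) :
  (forall x y, f (x + y) <= f x + f y) -> (forall x, `|f x| <= B * `|x|) ->
  continuous f.
Proof.
move=> fD fB x; apply/(@cvgrPdist_le _ _ _ _ (nbhs_filter x)) => e e0.
have B0 : 0 < `|B| + 1 by rewrite ltr_wpDl.
apply/nbhs_ballP; exists (e / (`|B| + 1)); first exact: divr_gt0.
move=> y; rewrite -ball_normE /= => xye.
have xy : `|f x - f y| <= (`|B| + 1) * `|x - y|.
  have fBB z : `|f z| <= (`|B| + 1) * `|z|.
    apply: (le_trans (fB z)); rewrite ler_wpM2r // ler_wpDr //; exact: ler_norm.
  rewrite ler_norml; apply/andP; split; last first.
    rewrite lerBlDr -[in leLHS](subrK y x); apply: (le_trans (fD _ _)).
    by rewrite lerD2r (le_trans (ler_norm _)).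
  rewrite lerNl opprB lerBlDr -[in leLHS](subrK x y); apply: (le_trans (fD _ _)).
  by rewrite lerD2r (le_trans (ler_norm _)) // distrC.
apply: (le_trans xy); rewrite -ler_pdivlMl // mulrC; exact: ltW.
Qed.

Lemma body_norm_le {R : realType} {n : nat} {K : set 'rV[R]_n} (t : R)
    (x : 'rV[R]_n) : convex_body K -> symmetric_set K -> 0 < t ->
  body_norm K x <= t <-> K (t^-1 *: x).
Proof.
move=> bK sK t0; rewrite -{2}(body_norm_ball bK sK) /= body_normZ //.
by rewrite gtr0_norm ?invr_gt0 // ler_pdivrMl // mulr1.
Qed.

Lemma body_norm_le1 {R : realType} {n : nat} {K : set 'rV[R]_n}
    (x : 'rV[R]_n) : convex_body K -> symmetric_set K ->
  body_norm K x <= 1 <-> K x.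
Proof. by move=> bK sK; rewrite body_norm_le // invr1 scale1r. Qed.

(** As [t / 2] is at most 1, its power [p] is at most its square. This turns a quadratic modulus of
    convexity into one of power [p], at the price of a constant depending on [p]. *)
Lemma powR_le_sqr {R : realType} (p t : R) : 2 <= p -> 0 <= t -> t <= 2 ->
  t `^ p <= 2 `^ p / 4 * t ^+ 2.
Proof.
move=> p2; rewrite le_eqVlt => /predU1P[<- _|t0 t2].
  by rewrite powR0 ?expr0n ?mulr0 // gt_eqF // (lt_le_trans _ p2).
have -> : t `^ p = 2 `^ p * (t / 2) `^ p.
  by rewrite -powRM ?divr_ge0 ?(ltW t0) // mulrCA divff // mulr1.
rewrite -mulrA ler_pM2l ?powR_gt0 //.
have -> : 4^-1 * t ^+ 2 = (t / 2) `^ 2.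
  by rewrite powR_mulrn ?divr_ge0 ?(ltW t0) //; field.
by rewrite ger_powR // divr_gt0 //= ler_pdivrMr // mul1r.
Qed.

(** * The rounded body and its uniform convexity *)

Section rounding.
Context {R : realType} {n : nat} {P : set 'rV[R]_n}.
Hypotheses (bP : convex_body P) (sP : symmetric_set P).

(** Triangle inequality along the standard basis. It compares the norm of [P] with both the sup norm
    and the Euclidean norm. *)
Lemma body_norm_le_coords (c : R) (x : 'rV[R]_n) : (forall i, `|x 0 i| <= c) ->
  body_norm P x <= c * \sum_(i < n) body_norm P 'e_i.
Proof.
move=> xc; rewrite [in leLHS](row_sum_delta x) mulr_sumr.
elim/big_ind2 : _ => [|u a v b ua vb|i _].
- by rewrite -(scale0r (0 : 'rV[R]_n)) body_normZ // normr0 mul0r.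
- exact: le_trans (body_normD bP sP _ _) (lerD ua vb).
- by rewrite body_normZ // ler_wpM2r // body_norm_ge0.
Qed.

Lemma body_norm_continuous : continuous (body_norm P).
Proof.
apply: (@continuous_subadditive _ _ _ (\sum_(i < n) body_norm P 'e_i)).
  exact: body_normD.
move=> x; rewrite ger0_norm ?body_norm_ge0 // mulrC.
by apply: body_norm_le_coords => i; exact: norm_coord_le.
Qed.

Lemma body_norm_sqnorm :
  exists2 L : R, 0 <= L & forall x, body_norm P x ^+ 2 <= L * sqnorm x.
Proof.
exists ((\sum_(i < n) body_norm P 'e_i) ^+ 2); first exact: sqr_ge0.
move=> x; rewrite -[sqnorm x]sqr_sqrtr ?sqnorm_ge0 // -exprMn.
rewrite ler_sqr ?nnegrE ?body_norm_ge0 //; last first.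
  by rewrite mulr_ge0 ?sqrtr_ge0 // sumr_ge0 // => i _; exact: body_norm_ge0.
rewrite mulrC; apply: body_norm_le_coords => i.
rewrite -sqrtr_sqr ler_sqrt ?sqnorm_ge0 //.
by rewrite /sqnorm (bigD1 i) //= lerDl sumr_ge0 // => j _; exact: sqr_ge0.
Qed.

Lemma sqnorm_bounded : exists2 C : R, 0 < C & forall x, P x -> sqnorm x <= C.
Proof.
have [_ /compact_bounded[M [_ MP]] _] := bP.
pose N := `|M| + 1.
(* The summand 1 keeps the bound positive even when [n] is 0. *)
exists (1 + \sum_(i < n) N ^+ 2).
  by rewrite ltr_pwDl // sumr_ge0 // => i _; exact: sqr_ge0.
move=> x Px; rewrite ler_wpDl //; apply: ler_sum => i _.
have xN : `|x| <= N by apply: MP Px; rewrite ltr_pwDr ?ler_norm.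
rewrite -(real_normK (num_real _)) ler_sqr ?nnegrE //; last first.
  by rewrite /N addr_ge0.
exact: le_trans (norm_coord_le x i) xN.
Qed.

(** The square of the norm whose unit ball is [round_body e], as [body_norm_round] shows. *)
Definition round_sq (e : R) (x : 'rV[R]_n) : R :=
  body_norm P x ^+ 2 + e * sqnorm x.

Definition round_body (e : R) : set 'rV[R]_n := [set x | round_sq e x <= 1].

Variable e : R.
Hypothesis e0 : 0 < e.

Lemma round_sq_ge0 x : 0 <= round_sq e x.
Proof. by rewrite addr_ge0 ?sqr_ge0 // mulr_ge0 ?sqnorm_ge0 // ltW. Qed.

Lemma round_sqZ a x : round_sq e (a *: x) = a ^+ 2 * round_sq e x.
Proof.
by rewrite /round_sq body_normZ // sqnormZ exprMn real_normK ?num_real //; ring.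
Qed.

(** The norm of [P] enters only through convexity of its square; the gain, the subtracted term,
    comes from the Euclidean part alone. *)
Lemma round_sq_conv a b x y : 0 <= a -> 0 <= b -> a + b = 1 ->
  round_sq e (a *: x + b *: y) <=
  a * round_sq e x + b * round_sq e y - a * b * (e * sqnorm (x - y)).
Proof.
move=> a0 b0 ab; rewrite /round_sq sqnorm_conv //.
set u := body_norm P x; set v := body_norm P y.
have uv : body_norm P (a *: x + b *: y) <= a * u + b * v.
  apply: (le_trans (body_normD bP sP _ _)).
  by rewrite !body_normZ // !ger0_norm.
have uv2 : body_norm P (a *: x + b *: y) ^+ 2 <= (a * u + b * v) ^+ 2.
  rewrite ler_sqr ?nnegrE ?body_norm_ge0 // addr_ge0 // mulr_ge0 //;
    exact: body_norm_ge0.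
have : (a * u + b * v) ^+ 2 <= a * u ^+ 2 + b * v ^+ 2.
  have -> : b = 1 - a by rewrite -ab addrAC subrr add0r.
  have -> : (a * u + (1 - a) * v) ^+ 2 =
    a * u ^+ 2 + (1 - a) * v ^+ 2 - a * (1 - a) * (u - v) ^+ 2 by ring.
  rewrite gerBl mulr_ge0 ?sqr_ge0 // mulr_ge0 //.
  by rewrite -ab addrAC subrr add0r.
move: uv2; move: (body_norm P (_ + _)) (sqnorm (x - y)) => w q; lra.
Qed.

Lemma round_sq_continuous : continuous (round_sq e).
Proof.
have c1 : continuous (fun x => body_norm P x ^+ 2).
  move=> x; apply: (@continuous_comp _ _ _ (body_norm P) (fun t => t ^+ 2)).
    exact: body_norm_continuous.
  exact: exprn_continuous.
move=> x; rewrite /round_sq /=; apply: (@cvgD _ _ _ _ (nbhs_filter x)).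
  exact: c1.
by apply: (@cvgM _ _ _ (nbhs_filter x)); [exact: cvg_cst|
  exact: sqnorm_continuous].
Qed.

Lemma round_body_sub : round_body e `<=` P.
Proof.
move=> x; rewrite /round_body /= => x1; apply/body_norm_le1 => //.
rewrite -(@expr_le1 _ 2) ?body_norm_ge0 //; apply: le_trans x1.
by rewrite lerDl mulr_ge0 ?sqnorm_ge0 // ltW.
Qed.

Lemma round_body_convex_body : convex_body (round_body e).
Proof.
have [_ cP _] := bP; split.
- move=> x y l; rewrite !inE /= => x1 y1.
  have l0 : 0 <= l%:num by [].
  have l1 : 0 <= 1 - l%:num by rewrite subr_ge0.
  have l01 : l%:num + (1 - l%:num) = 1 by rewrite addrC subrK.
  apply: (le_trans (round_sq_conv _ _ x y l0 l1 l01)).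
  have q0 : 0 <= l%:num * (1 - l%:num) * (e * sqnorm (x - y)).
    by rewrite !mulr_ge0 ?sqnorm_ge0 // ltW.
  have := ler_wpM2l l0 x1; have := ler_wpM2l l1 y1.
  rewrite /=; lra.
- apply: (subclosed_compact _ cP round_body_sub).
  have -> : round_body e = round_sq e @^-1` [set t | t <= 1] by [].
  apply: preimage_closed; last exact: closed_le.
  by move=> x _; exact: round_sq_continuous.
(* The strict sublevel set is open, contains 0 and lies in the body. *)
- exists 0; have o1 : open (round_sq e @^-1` [set t | t < 1]).
    apply: open_comp => [x _|]; first exact: round_sq_continuous.
    exact: open_lt.
  apply: (@filterS _ _ (nbhs_filter _) (round_sq e @^-1` [set t | t < 1])).
    by move=> x /= /ltW.
  apply: open_nbhs_nbhs; split => //.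
  by rewrite /= -(scale0r (0 : 'rV[R]_n)) round_sqZ expr0n mul0r.
Qed.

Lemma round_body_symmetric : symmetric_set (round_body e).
Proof.
by move=> x; rewrite /round_body /= -scaleN1r round_sqZ sqrrN expr1n mul1r.
Qed.

(** Both the norm and the root of [round_sq e x] are nonnegative and lie below the same positive
    thresholds [t]. Adding an arbitrary [d > 0] supplies such thresholds. *)
Lemma body_norm_round x : body_norm (round_body e) x ^+ 2 = round_sq e x.
Proof.
have bK := round_body_convex_body; have sK := round_body_symmetric.
have le_sqr t : 0 < t ->
    body_norm (round_body e) x <= t <-> Num.sqrt (round_sq e x) <= t.
  move=> t0; rewrite body_norm_le // /round_body /= round_sqZ exprVn.
  rewrite ler_pdivrMl ?exprn_gt0 // mulr1.
  rewrite -[in X in _ <-> X](ger0_norm (ltW t0)) -sqrtr_sqr.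
  by rewrite ler_sqrt ?exprn_ge0 // ltW.
rewrite -[RHS]sqr_sqrtr ?round_sq_ge0 //; congr (_ ^+ 2).
have N0 := body_norm_ge0 bK sK x; have s0 := sqrtr_ge0 (round_sq e x).
apply/le_anti/andP; split; apply/ler_addgt0Pr => d d0.
  by apply/le_sqr; [rewrite ltr_wpDl|rewrite lerDl ltW].
by apply/le_sqr; [rewrite ltr_wpDl|rewrite lerDl ltW].
Qed.

(** The Euclidean gain at the midpoint gives a quadratic modulus for the square of the norm. Then
    [powR_le_sqr] passes to power [p], since two points of the body are at distance at most 2. *)
Lemma round_body_uniformly_convex p :
  2 <= p -> p_uniformly_convex_body p (round_body e).
Proof.
move=> p2; have bK := round_body_convex_body; have sK := round_body_symmetric.
split=> //; have [L L0 PL] := body_norm_sqnorm.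
(* [round_sq e z] is at most [(L + e) * sqnorm z], so the midpoint gain [e / 4 * sqnorm (x - y)] is
   at least [d] times the squared norm of [x - y]. *)
pose d := e / (4 * (L + e)).
have Le0 : 0 < L + e by rewrite ltr_wpDl.
have d0 : 0 < d by rewrite divr_gt0 // mulr_gt0.
have tp0 : 0 < 2 `^ p :> R by rewrite powR_gt0.
(* With [powR_le_sqr] this constant costs at most [d * t ^+ 2 / 2], which is what remains of the
   gain once the square on the midpoint norm is removed. *)
exists (2 * d / 2 `^ p); first by rewrite divr_gt0 // mulr_gt0.
have cK : closure (round_body e) = round_body e.
  have [_ kK _] := bK; symmetry; apply/closure_id.
  exact: compact_closed (@norm_hausdorff _ _) kK.
move=> x y [+ _] [+ _]; rewrite cK => Kx Ky.
have Nxy2 : body_norm (round_body e) (x - y) <= 2.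
  apply: (le_trans (body_normD bK sK _ _)).
  rewrite -[2]/(1 + 1) lerD //; apply/body_norm_le1 => //; exact: sK.
have mid : body_norm (round_body e) (2^-1 *: (x + y)) ^+ 2 <=
    1 - d * body_norm (round_body e) (x - y) ^+ 2.
  rewrite !body_norm_round scalerDr.
  have h0 : 0 <= 2^-1 :> R by rewrite invr_ge0.
  have h1 : 2^-1 + 2^-1 = 1 :> R by rewrite [RHS]splitr mul1r.
  apply: (le_trans (round_sq_conv _ _ x y h0 h0 h1)).
  have : d * round_sq e (x - y) <= 2^-1 * 2^-1 * (e * sqnorm (x - y)).
    rewrite /d mulrAC ler_pdivrMr ?mulr_gt0 //.
    have -> : 2^-1 * 2^-1 * (e * sqnorm (x - y)) * (4 * (L + e)) =
      e * ((L + e) * sqnorm (x - y)) by field.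
    by rewrite ler_pM2l // mulrDl lerD2r.
  move: Kx Ky; rewrite /round_body /=; lra.
move: mid Nxy2 (body_norm_ge0 bK sK (x - y)).
move: (body_norm _ (x - y)) (body_norm _ (2^-1 *: (x + y))) => t m mid t2 t0.
have := powR_le_sqr p t p2 t0 t2.
rewrite -(ler_pM2l (_ : 0 < 2 * d / 2 `^ p)); last first.
  by rewrite divr_gt0 // mulr_gt0.
have -> : 2 * d / 2 `^ p * (2 `^ p / 4 * t ^+ 2) = d * t ^+ 2 / 2.
  by field; rewrite gt_eqF.
(* [m <= (1 + m^2) / 2] *)
have := sqr_ge0 (m - 1); nra.
Qed.

End rounding.

(** * Approximation from inside and the volume estimate *)

(** A single body between [s P] and [P] serves every exponent [p]; only the convexity constant
    varies with [p]. *)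
Lemma convex_body_inner_approximation {R : realType} {n : nat}
    {P : set 'rV[R]_n} (s : R) :
  convex_body P -> symmetric_set P -> 0 < s -> s < 1 ->
  exists K : set 'rV[R]_n,
    [/\ K `<=` P, [set x | P (s^-1 *: x)] `<=` K &
        forall p, 2 <= p -> p_uniformly_convex_body p K].
Proof.
move=> bP sP s0 s1; have [C C0 PC] := sqnorm_bounded bP.
(* Chosen so that [1 + e * C = s ^- 2]: then [round_sq e] is at most [s ^- 2] on [P], hence at most
   1 on [s P]. *)
pose e := (s ^- 2 - 1) / C.
have e0 : 0 < e.
  by rewrite divr_gt0 // subr_gt0 invf_gt1 ?exprn_gt0 // exprn_ilt1 // ltW.
exists (@round_body R n P e); split.
- exact: round_body_sub.
- move=> x /= Px; rewrite /round_body /=.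
  have -> : x = s *: (s^-1 *: x) by rewrite scalerA divff ?gt_eqF // scale1r.
  rewrite round_sqZ // -ler_pdivlMl ?exprn_gt0 // mulr1 /round_sq.
  have -> : s ^- 2 = 1 + e * C by rewrite /e divfK ?gt_eqF // addrC subrK.
  apply: lerD; last by rewrite ler_pM2l // PC.
  rewrite exprn_ile1 ?body_norm_ge0 //; exact/body_norm_le1.
- by move=> p p2; apply: round_body_uniformly_convex.
Qed.

(** Bernoulli's inequality; it bounds the fraction of volume lost in shrinking [P] to [s P]. *)
Lemma bernoulli_sub {R : realType} (n : nat) (s : R) : 0 <= s <= 1 ->
  1 - s ^+ n <= n%:R * (1 - s).
Proof.
move=> /andP[s0 s1]; elim: n => [|n IH]; first by rewrite expr0 subrr mul0r.
have sn : s ^+ n <= 1 by rewrite exprn_ile1.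
rewrite exprS -natr1; have := mulr_ge0 s0 (_ : 0 <= 1 - s ^+ n).
nra.
Qed.

Theorem theorem1p2 (R : realType) (n : nat) (P : set 'rV[R]_n)
    (polyP : polytope P) (symP : symmetric_set P) :
  exists2 p0 : R, 2 <= p0 &
    forall p : R, p0 <= p ->
      exists2 K : set 'rV[R]_n, p_uniformly_convex_body p K &
        (symdiff_dist P K <=
         (2 * n%:R ^+ 2)%:E * volume P * (ln p / p)%:E)%E.
Proof.
(* The threshold 2 suffices for every [P], since [ln p / p] already lies strictly between 0 and 1
   there, which makes [s] a legitimate ratio. *)
exists 2 => // p p2; have [bP _] := polyP.
have p0 : 0 < p by exact: lt_le_trans p2.
have l0 : 0 < ln p / p.
  by rewrite divr_gt0 // ln_gt0 // (lt_le_trans _ p2) // ltr1n.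
have l1 : ln p / p < 1 by rewrite ltr_pdivrMr // mul1r ln_sublinear.
pose s := 1 - ln p / p.
have s0 : 0 < s by rewrite subr_gt0.
have s1 : s < 1 by rewrite ltrBlDr ltrDl.
have [K [KP sPK /(_ p p2) Kp]] :=
  convex_body_inner_approximation s bP symP s0 s1.
exists K => //; have [[_ kK _] _ _] := Kp; have [_ kP _] := bP.
have cP := compact_closed (@norm_hausdorff _ _) kP.
have mP := measurable_closed_tuple cP.
have mK := measurable_closed_tuple (compact_closed (@norm_hausdorff _ _) kK).
have msP := measurable_closed_tuple (closed_scale _ _ s^-1 _ cP).
have vPfin : volume P \is a fin_num.
  by rewrite ge0_fin_numE ?volume_compact_lty // measure_ge0.
have vK : ((s ^+ n)%:E * volume P <= volume K)%E.
  rewrite -volume_scale //; apply: le_measure; rewrite ?inE // => t; exact: sPK.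
(* As [K] lies in [P], the symmetric difference is [P] minus [K]. *)
have -> : symdiff_dist P K = (volume P - volume K)%E.
  rewrite /symdiff_dist /volume.
  rewrite (_ : [set t | _] = [set t | P (\row_i tnth t i)] `\`
                            [set t | K (\row_i tnth t i)]); last first.
    apply/seteqP; split => t /=; last by left.
    by case=> // -[/KP].
  rewrite measureD //; last exact: volume_compact_lty.
  by congr (_ - lebesgue_tuple _)%E; apply: setIidr => t; exact: KP.
have vP0 : 0 <= fine (volume P) by rewrite fine_ge0 ?measure_ge0.
apply: (@le_trans _ _ (volume P - (s ^+ n)%:E * volume P)%E).
  exact: leeB.
(* Finiteness of the volume moves the estimate to the reals, where the volume of [P] factors out. *)
rewrite -(fineK vPfin) -!EFinM -EFinB lee_fin.
rewrite -[X in X - _]mul1r -mulrBl mulrAC ler_wpM2r //.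
apply: (le_trans (bernoulli_sub n s _)); first by rewrite !ltW.
rewrite (_ : 1 - s = ln p / p); last by rewrite /s subKr.
rewrite ler_wpM2r ?(ltW l0) // -natrX -natrM ler_nat.
(* The factor [n] obtained is at most [2 * n ^ 2]; for [n = 0] both are 0. *)
by case: (n) => // k; rewrite mulnCA leq_pmulr.
Qed.
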